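(* For every $d\geq 2$ there is a collapsible and shellable $d$-dimensional simplicial complex $\Sigma_d$ with $2^d+d+1$ vertices that has exactly one free face.
   Context: A face $\sigma$ of a simplicial complex $C$ is free if it is properly contained in exactly one other face $\tau$ of $C$; removing $\sigma$ and $\tau$ is an elementary collapse. $C$ is collapsible if it can be reduced to a single vertex by a finite sequence of elementary collapses. Shellability is meant in the usual sense for pure simplicial complexes. *)

(* Defs.v *)
From HB Require Import structures.
From mathcomp Require Import all_boot all_order all_algebra.

Set Implicit Arguments.
Unset Strict Implicit.
Unset Printing Implicit Defensive.

Section SimplicialComplexes.
Variable T : finType.
Implicit Types (C D : {set {set T}}) (F sigma tau : {set T}) (s : seq {set T}).

(* The empty face belongs to every complex. An element of T need not be a
   vertex of the complex. *)
Definition is_complex C : Prop :=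
  set0 \in C /\ forall F G : {set T}, F \in C -> G \subset F -> G \in C.

Definition vertices C : {set T} := [set v | [set v] \in C].

(* Integer-valued, so that the empty face has dimension -1. *)
Definition face_dim F : int := (#|F|%:Z - 1)%R.

Definition complex_dim C : int := ((\max_(F in C) #|F|)%:Z - 1)%R.

Definition facets C : {set {set T}} := [set F | maxset [in C] F].

Definition pure C : Prop :=
  forall F, F \in facets C -> face_dim F = complex_dim C.

(* The empty face is free only in a complex consisting of a single vertex, so
   counting it as a face affects neither collapsibility nor the free faces of
   any larger complex. *)
Definition free_face C sigma : bool :=
  (sigma \in C) && (#|[set tau in C | sigma \proper tau]| == 1).

Definition elementary_collapse : rel {set {set T}} :=
  fun C D => [exists sigma, exists tau,
    [&& free_face C sigma, tau \in C, sigma \proper tau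
      & D == C :\: [set sigma; tau]]].

Definition collapsible C : Prop :=
  exists v : T, connect elementary_collapse C (powerset [set v]).

Definition generated_complex s : {set {set T}} :=
  \bigcup_(F <- s) powerset F.

Definition is_shelling C s : Prop :=
  [/\ uniq s, s =i facets C
    & forall k, 0 < k < size s ->
        let I := powerset (nth set0 s k) :&: generated_complex (take k s) in
        pure I /\ complex_dim I = (complex_dim C - 1)%R].

Definition shellable C : Prop := pure C /\ exists s, is_shelling C s.

End SimplicialComplexes.

(* Main.v *)
(** Record a shelling together with its restrictions: the faces that a facet F
    adds to the earlier ones are exactly those between a minimal one R and F.
    If R is always a proper subset of F, then each interval [R, F] can be
    collapsed, so the complex is collapsible as well as shellable. Two
    operations preserve this data and the existence of exactly one free ridge:
    stacking the first facet, which adds one vertex, and the one-point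
    suspension at a vertex of the free ridge, which adds one vertex and one
    dimension. It therefore suffices to start from one 2-complex with 7
    vertices: stack it 2^d - 4 times, then suspend it d - 2 times. *)
Require Import Defs.
From HB Require Import structures.
From mathcomp Require Import all_boot all_order all_algebra.
From mathcomp Require Import zify.

Set Implicit Arguments.
Unset Strict Implicit.
Unset Printing Implicit Defensive.

(** * Collapsing intervals of faces and simplices *)

Section Collapses.
Variable T : finType.
Implicit Types (C : {set {set T}}) (A F R : {set T}).

(** Induction on the size of [F :\: R]. If [F] has a further vertex [y] outside [R], the interval
    splits into the faces containing [y] and those avoiding it, that is [R + y, F] and [R, F - y];
    they are collapsed in that order, [x] staying available for both. Otherwise F = R + x and [R] is
    free. *)
Lemma collapse_interval C F R (x : T) :
    R \subset F -> x \in F -> x \notin R ->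
    (forall A, R \subset A -> (A \in C) = (A \subset F)) ->
  connect (@elementary_collapse T) C (C :\: [set A : {set T} | R \subset A]).
Proof.
move En: #|F :\: R| => n; elim: n C F R En => [|n IHn] C F R En RF xF xR CE.
  move/eqP: En; rewrite cards_eq0 setD_eq0 => /subsetP/(_ x xF).
  by rewrite (negbTE xR).
case: (pickP [pred y in F :\: R | y != x]) => [y /andP[]|yP].
  rewrite inE => /andP[yR yF] yx.
  pose C1 := C :\: [set A : {set T} | y |: R \subset A].
  have CC1 : connect (@elementary_collapse T) C C1.
    apply: (IHn C F) => //.
    - have yFR : y \in F :\: R by rewrite inE yR.
      have := cardsD1 y (F :\: R); rewrite yFR En add1n => -[->].
      by rewrite setDDl setUC.
    - by rewrite subUset sub1set yF.
    - by rewrite !inE negb_or eq_sym yx.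
    - by move=> A; rewrite subUset => /andP[_ /CE].
  apply: connect_trans CC1 _.
  have -> : C :\: [set A : {set T} | R \subset A] = C1 :\: [set A : {set T} | R \subset A].
    apply/setP=> A; rewrite !inE subUset.
    by case: (R \subset A); rewrite ?andbF ?andbT.
  apply: (IHn C1 (F :\ y)).
  - have yFR : y \in F :\: R by rewrite inE yR.
    have := cardsD1 y (F :\: R); rewrite yFR En add1n => -[->].
    by rewrite !setDDl setUC.
  - by rewrite subsetD1 RF.
  - by rewrite !inE eq_sym yx.
  - by [].
  - move=> A RA; rewrite !inE subUset RA andbT sub1set CE // subsetD1.
    by rewrite andbC.
have FE : F = x |: R.
  apply/setP=> y; rewrite !inE; have := yP y; rewrite !inE.
  case: eqVneq => [-> //|_] /=; case: (boolP (y \in R)) => [/(subsetP RF) //|_].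
  by rewrite andbT.
have RpF : R \proper F by rewrite FE properUr // sub1set.
(* The interval now consists of [R] and [F] alone, so removing it is one elementary collapse. *)
apply: connect1; apply/existsP; exists R; apply/existsP; exists F.
have inC A : R \subset A -> (A \in C) = ((A == R) || (A == F)).
  move=> RA; rewrite CE //; apply/idP/orP => [AF|[]/eqP-> //].
  case: (boolP (x \in A)) => [xA|xA].
    by right; rewrite eqEsubset AF FE subUset sub1set xA.
  left; rewrite eqEsubset RA andbT; apply/subsetP=> z zA.
  move/subsetP/(_ z zA): AF; rewrite FE !inE => /predU1P[zx|//].
  by rewrite -zx zA in xA.
apply/and4P; split => //.
- rewrite /free_face inC // eqxx /=; apply/cards1P; exists F.
  apply/setP=> A; rewrite !inE; apply/andP/eqP => [[AC RA]|->].
    move: AC; rewrite inC ?proper_sub // => /predU1P[AR|/eqP //].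
    by rewrite AR properxx in RA.
  by rewrite inC ?proper_sub // eqxx orbT.
- by rewrite inC ?proper_sub // eqxx orbT.
- apply/eqP/setP=> A; rewrite !inE.
  case: (boolP (R \subset A)) => [/inC->|RA] /=; first by case: (_ || _).
  case: eqVneq => [AR|_] /=; first by rewrite AR subxx in RA.
  by case: eqVneq => // AF; rewrite AF RF in RA.
Qed.

(** Each vertex [y] other than [v] is removed by collapsing the interval [{y}, F], which leaves the
    full simplex on [F :\ y]. *)
Lemma collapse_simplex F (v : T) : v \in F ->
  connect (@elementary_collapse T) (powerset F) (powerset [set v]).
Proof.
move En: #|F| => n; elim: n F En => [|n IHn] F En vF.
  by move/eqP: En; rewrite cards_eq0 => /eqP F0; rewrite F0 inE in vF.
case: (pickP [pred y in F | y != v]) => [y /andP[/= yF yv]|yP].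
  have FyE : powerset (F :\ y) = powerset F :\: [set A : {set T} | [set y] \subset A].
    by apply/setP=> A; rewrite !inE sub1set subsetD1 andbC.
  apply: (@connect_trans _ _ (powerset (F :\ y))).
    rewrite FyE; apply: (@collapse_interval _ F [set y] v) => //.
    - by rewrite sub1set.
    - by rewrite inE eq_sym.
    - by move=> A _; rewrite inE.
  apply: IHn; last by rewrite !inE eq_sym yv.
  by have := cardsD1 y F; rewrite yF En add1n => -[].
suff -> : F = [set v] by exact: connect0.
apply/setP=> y; rewrite inE; have := yP y; rewrite inE /=.
by case: eqVneq => [->|_] /=; rewrite ?andbT.
Qed.

End Collapses.

(** * Shellings with restrictions, and what they imply *)

Section RestrictedShellings.
Variable T : finType.
Implicit Types (s : seq {set T}) (A F G R : {set T}).

(** Only minimal data are recorded: [R] itself is new, and each ridge of [F] opposite a vertex of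
    [R] is old. Together they determine which subsets of [F] are new. *)
Definition restriction s F R : Prop :=
  (forall G, G \in s -> ~~ (R \subset G)) /\
  (forall y, y \in R -> exists2 G : {set T}, G \in s & F :\ y \subset G).

(* The facets are listed in reverse order: the head is added last. *)
Fixpoint proper_shelling d s : Prop :=
  if s is F :: s' then
    [/\ #|F| = d.+1, exists2 R : {set T}, R \proper F & restriction s' F R
      & proper_shelling d s']
  else True.

(** The invariant kept by both operations. Freeness is expressed by counting the facets through a
    [d]-element set, and covering ensures that every element of [T] is a vertex. *)
Record unique_ridge_shelling d s (sigma : {set T}) : Prop := UniqueRidge {
  urs_shelling : proper_shelling d s;
  urs_cover : forall t, exists2 F : {set T}, F \in s & t \in F;
  urs_card : #|sigma| = d;
  urs_free : forall A, #|A| = d ->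
    (count (fun F => A \subset F) s == 1) = (A == sigma) }.

Lemma generatedP s A :
  reflect (exists2 F : {set T}, F \in s & A \subset F) (A \in generated_complex s).
Proof.
rewrite /generated_complex; elim: s => [|F s IHs].
  by rewrite big_nil inE; constructor=> -[].
rewrite big_cons !inE; apply: (iffP orP) => [[AF|/IHs[G Gs AG]]|[G]].
- by exists F; rewrite ?mem_head.
- by exists G; rewrite // inE Gs orbT.
- rewrite inE => /predU1P[->|Gs AG]; first by left.
  by right; apply/IHs; exists G.
Qed.

Lemma eq_generated s1 s2 :
  s1 =i s2 -> generated_complex s1 = generated_complex s2.
Proof.
move=> s12; apply/setP=> A.
by apply/generatedP/generatedP => -[F Fs AF]; exists F; rewrite ?s12 // -s12.
Qed.

Lemma restriction_generated s F R A : restriction s F R -> A \subset F ->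
  (A \in generated_complex s) = ~~ (R \subset A).
Proof.
move=> [Rnew Rold] AF; apply/generatedP/idP => [[G Gs AG]|].
  by apply: contra (Rnew G Gs) => /subset_trans; apply.
move=> /subsetPn[y yR yA]; have [G Gs FG] := Rold y yR; exists G => //.
by apply: subset_trans FG; rewrite subsetD1 AF.
Qed.

Lemma proper_shelling_card d s F :
  proper_shelling d s -> F \in s -> #|F| = d.+1.
Proof.
elim: s => [//|G s IHs] /= [cG _ sh]; rewrite inE => /predU1P[-> //|].
exact: IHs.
Qed.

Lemma restriction_notin s F R : R \subset F -> restriction s F R -> F \notin s.
Proof. by move=> RF [Rnew _]; apply/negP => /Rnew; rewrite RF. Qed.

Lemma proper_shelling_uniq d s : proper_shelling d s -> uniq s.
Proof.
elim: s => [//|F s IHs] /= [_ [R /proper_sub RF res] /IHs->].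
by rewrite (restriction_notin RF res).
Qed.

(** The shelling is undone from its last facet: removing [F] deletes exactly the interval [R, F],
    which collapses because [R] is proper. The first facet remains, a simplex. *)
Lemma proper_shelling_collapsible d s :
  proper_shelling d s -> s != [::] -> collapsible (generated_complex s).
Proof.
elim: s => [//|F s IHs] /= [cF [R RF res] sh] _.
have /properP[sRF [x xF xR]] := RF.
case: s IHs res sh => [_ _ _|G s /(_ _ isT) IHs res sh].
  exists x; rewrite /generated_complex big_seq1; exact: collapse_simplex.
have [v cv] := IHs sh; exists v; apply: connect_trans cv.
have -> : generated_complex (G :: s)
    = generated_complex [:: F, G & s] :\: [set A : {set T} | R \subset A].
  rewrite {2}/generated_complex big_cons -/(generated_complex (G :: s)).
  apply/setP=> A; rewrite !inE; case: (boolP (A \subset F)) => [AF|AF] /=.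
    by rewrite (restriction_generated res AF) andbT.
  case: (boolP (R \subset A)) => //= RA; apply/negP => /generatedP[H Hs AH].
  by have := res.1 H Hs; rewrite (subset_trans RA AH).
apply: (@collapse_interval _ _ F R x) => // A RA.
apply/generatedP/idP => [[H]|AF]; last by exists F; rewrite ?mem_head.
rewrite inE => /predU1P[-> //|Hs AH].
by have := res.1 H Hs; rewrite (subset_trans RA AH).
Qed.

Lemma complex_dim_eq (C : {set {set T}}) n F :
    F \in C -> #|F| = n -> (forall A, A \in C -> #|A| <= n) ->
  complex_dim C = (n%:Z - 1)%R.
Proof.
move=> FC cF Cn; rewrite /complex_dim; congr (_%:Z - 1)%R.
apply/eqP; rewrite eqn_leq; apply/andP; split.
  by apply/bigmax_leqP => A; apply: Cn.
by rewrite -cF; exact: (leq_bigmax_cond (F := fun A : {set T} => #|A|) F FC).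
Qed.

Lemma facet_generated d s F :
    (forall G, G \in s -> #|G| = d) ->
  (F \in facets (generated_complex s)) = (F \in s).
Proof.
move=> cs; rewrite inE; apply/maxsetP/idP => [[/generatedP[G Gs FG] max]|Fs].
  by rewrite -(max G) //; apply/generatedP; exists G.
split=> [|A /generatedP[G Gs AG] FA]; first by apply/generatedP; exists F.
have FG : F = G.
  by apply/eqP; rewrite eqEcard (subset_trans FA AG) (cs F) // (cs G) //=.
by apply/eqP; rewrite eqEsubset FA {1}FG AG.
Qed.

Lemma pure_generated d s :
    (forall G, G \in s -> #|G| = d) -> s != [::] ->
  pure (generated_complex s) /\ complex_dim (generated_complex s) = (d%:Z - 1)%R.
Proof.
case: s => [//|F0 s] cs _; set s' := F0 :: s in cs *.
have dimE : complex_dim (generated_complex s') = (d%:Z - 1)%R.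
  apply: (@complex_dim_eq _ _ F0); last 1 first.
  - by move=> A /generatedP[G /cs<- /subset_leq_card].
  - by apply/generatedP; exists F0; rewrite ?mem_head.
  - by rewrite cs ?mem_head.
by split=> // F; rewrite (facet_generated _ cs) => /cs; rewrite /face_dim dimE => ->.
Qed.

(** A subset of [F] is old exactly when it misses some [y] in [R], that is when it lies in the ridge
    [F :\ y]. This makes the intersection pure of codimension one. *)
Lemma restriction_boundary s F R :
    R \subset F -> restriction s F R ->
  powerset F :&: generated_complex s
    = generated_complex [seq F :\ y | y <- enum R].
Proof.
move=> RF res; apply/setP=> A; rewrite !inE; apply/andP/generatedP.
  move=> [AF]; rewrite (restriction_generated res AF) => /subsetPn[y yR yA].
  exists (F :\ y); last by rewrite subsetD1 AF.
  by apply/mapP; exists y; rewrite ?mem_enum.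
move=> [_ /mapP[y yR ->]]; rewrite mem_enum in yR; rewrite subsetD1 => /andP[AF yA].
by rewrite (restriction_generated res AF); split=> //; apply/subsetPn; exists y.
Qed.

Lemma proper_shelling_drop d s n F s' :
    proper_shelling d s -> drop n s = F :: s' ->
  exists2 R : {set T}, R \proper F & restriction s' F R.
Proof.
elim: s n => [|G s IHs] [|n] //= [_ ex sh]; last exact: IHs.
by case=> <- <-.
Qed.

Lemma proper_shelling_shellable d s :
  proper_shelling d s -> s != [::] -> shellable (generated_complex s).
Proof.
move=> sh s0; have cs := fun F => @proper_shelling_card d s F sh.
have [pC dimC] := pure_generated cs s0.
split=> //; exists (rev s); split.
- by rewrite rev_uniq (proper_shelling_uniq sh).
- by move=> F; rewrite mem_rev (facet_generated _ cs).
move=> k; rewrite size_rev => /andP[k0 ks] I.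
have nks : size s - k.+1 < size s by lia.
have E := drop_nth set0 nks.
(* Entry [k] of [rev s] is entry [size s - k.+1] of [s], and the facets before it in the shelling
   are those of [drop (size s - k) s]. *)
have nE : (size s - k.+1).+1 = size s - k by lia.
set F := nth _ _ _ in E; rewrite nE in E.
have [R RF res] := proper_shelling_drop sh E.
have IE : I = generated_complex [seq F :\ y | y <- enum R].
  rewrite -(restriction_boundary (proper_sub RF) res) /I nth_rev //.
  congr (_ :&: _); apply: eq_generated => G.
  by rewrite take_rev mem_rev.
have cF : #|F| = d.+1 by apply: cs; apply: mem_nth.
rewrite IE dimC.
have -> : (d.+1%:Z - 1 - 1 = d%:Z - 1)%R by lia.
apply: pure_generated.
  move=> G /mapP[y]; rewrite mem_enum => yR ->.
  have := cardsD1 y F; rewrite (subsetP (proper_sub RF) y yR) cF add1n.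
  by case.
(* An empty restriction would lie in every earlier facet, and there is one since k > 0. *)
rewrite -size_eq0 size_map -cardE; apply/negP; rewrite cards_eq0 => /eqP R0.
have nk : size s - k < size s by lia.
have Gs : nth set0 s (size s - k) \in drop (size s - k) s.
  by rewrite (drop_nth set0 nk) mem_head.
by have := res.1 _ Gs; rewrite R0 sub0set.
Qed.

(** The unique face [B] above [A] must be a facet [F]. For [x] in [F] outside [A], the ridge
    [F :\ x] contains [A]; if it differed from [A] it would be a second face above it. *)
Lemma free_face_card d s A :
    (forall F, F \in s -> #|F| = d.+1) ->
  free_face (generated_complex s) A -> #|A| = d.
Proof.
move=> cs /andP[_ /cards1P[B BE]].
have inB D : (D \in generated_complex s) && (A \proper D) = (D == B).
  by move/setP/(_ D): BE; rewrite !inE.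
have /andP[/generatedP[F Fs BF] AB] : (B \in generated_complex s) && (A \proper B).
  by rewrite inB.
have /properP[AF [x xF xA]] := proper_sub_trans AB BF.
have FB : F = B.
  apply/eqP; rewrite -inB (proper_sub_trans AB BF) andbT.
  by apply/generatedP; exists F.
have /eqP AE : A == F :\ x.
  rewrite eqEsubset subsetD1 AF xA /=; apply/negPn/negP => FA.
  have /eqP FxB : F :\ x == B.
    rewrite -inB; apply/andP; split.
      by apply/generatedP; exists F; rewrite ?subsetDl.
    by rewrite properE subsetD1 AF xA.
  by move: xF; rewrite FB -FxB !inE eqxx.
have := cardsD1 x F; rewrite xF cs // add1n -AE.
by case.
Qed.

(** For cardinality reasons a face properly containing a [d]-element set is a facet, so counting
    faces above [A] amounts to counting facets. *)
Lemma free_face_count d s A :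
    (forall F, F \in s -> #|F| = d.+1) -> uniq s -> #|A| = d ->
  free_face (generated_complex s) A = (count (fun F => A \subset F) s == 1).
Proof.
move=> cs us cA.
have -> : count (fun F => A \subset F) s
    = #|[set F : {set T} in generated_complex s | A \proper F]|.
  rewrite -size_filter -(card_uniqP (filter_uniq _ us)).
  apply: eq_card => F; rewrite !inE mem_filter.
  apply/andP/andP => [[AF Fs]|[/generatedP[G Gs FG] AF]].
    split; first by apply/generatedP; exists F.
    by rewrite properEcard AF cA cs /=.
  have FE : F = G.
    by apply/eqP; rewrite eqEcard FG (cs G) // -cA; apply: proper_card.
  by rewrite (proper_sub AF) FE.
rewrite /free_face; case: eqP => [c1|_]; last by rewrite andbF.
rewrite andbT; move/eqP/cards1P: c1 => [F FE].
have : F \in [set F] by rewrite inE.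
rewrite -FE inE => /andP[/generatedP[G Gs FG] /proper_sub AF].
by apply/generatedP; exists G; rewrite // (subset_trans AF).
Qed.

Lemma unique_ridge_nonempty d s sigma :
  unique_ridge_shelling d s sigma -> s != [::].
Proof.
case=> _ _ cs /(_ sigma cs); rewrite eqxx.
by case: s.
Qed.

Lemma unique_ridge_complex d s sigma : unique_ridge_shelling d s sigma ->
  is_complex (generated_complex s) /\
  complex_dim (generated_complex s) = d%:Z%R /\
  #|vertices (generated_complex s)| = #|T| /\
  collapsible (generated_complex s) /\
  shellable (generated_complex s) /\
  #|[set A : {set T} | free_face (generated_complex s) A]| = 1.
Proof.
move=> H; have s0 := unique_ridge_nonempty H; case: H => sh cov csig fr.
have cs := fun F => @proper_shelling_card d s F sh.
split; [split|split; [|split; [|split; [|split]]]].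
- case: s s0 {sh cov fr cs} => [//|F s _].
  by apply/generatedP; exists F; rewrite ?mem_head ?sub0set.
- move=> F G /generatedP[H Hs FH] GF; apply/generatedP; exists H => //.
  exact: subset_trans FH.
- by rewrite (pure_generated cs s0).2; lia.
- apply: eq_card => t; rewrite !inE.
  have [F Fs tF] := cov t.
  by apply/generatedP; exists F; rewrite ?sub1set.
- exact: proper_shelling_collapsible sh s0.
- exact: proper_shelling_shellable sh s0.
- apply/eqP/cards1P; exists sigma; apply/setP=> A; rewrite !inE.
  have us := proper_shelling_uniq sh.
  apply/idP/eqP => [fA|->].
    have cA := free_face_card cs fA.
    by apply/eqP; rewrite -fr // -(free_face_count cs us cA).
  by rewrite (free_face_count cs us csig) fr.
Qed.

End RestrictedShellings.

(** * Adding a vertex, and stacking the first facet *)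

Section NewVertex.
Variable T : finType.
Implicit Types (s : seq {set T}) (A F G R : {set T}).

(** [None] is the new vertex. A face over [option T] is handled through its trace on [T] and one bit
    for [None]. *)
Definition lift_face F : {set option T} :=
  [set x | if x is Some y then y \in F else false].

Definition cone_face F : {set option T} :=
  [set x | if x is Some y then y \in F else true].

Definition trace (B : {set option T}) : {set T} := [set x | Some x \in B].

Lemma trace_subset (B D : {set option T}) :
  (B \subset D) = (trace B \subset trace D) && ((None \in B) ==> (None \in D)).
Proof.
apply/subsetP/andP => [BD|[/subsetP BD /implyP nBD] [y|]]; last exact: nBD.
  split; last by apply/implyP; apply: BD.
  by apply/subsetP => y; rewrite !inE; apply: BD.
by have := BD y; rewrite !inE.
Qed.

Lemma trace_lift F : trace (lift_face F) = F.
Proof. by apply/setP=> y; rewrite !inE. Qed.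

Lemma trace_cone F : trace (cone_face F) = F.
Proof. by apply/setP=> y; rewrite !inE. Qed.

Lemma card_trace (B : {set option T}) : #|B| = (None \in B) + #|trace B|.
Proof.
rewrite (cardsD1 None); congr addn.
rewrite -(card_imset (trace B) (@Some_inj _)).
apply: eq_card => -[y|]; rewrite !inE /=; last by apply/esym/imsetP => -[].
apply/idP/imsetP => [By|[z]]; first by exists y; rewrite ?inE.
by rewrite inE => Bz [->].
Qed.

Lemma card_lift F : #|lift_face F| = #|F|.
Proof. by rewrite card_trace trace_lift inE. Qed.

Lemma card_cone F : #|cone_face F| = #|F|.+1.
Proof. by rewrite card_trace trace_cone inE. Qed.

Lemma traceD1 (B : {set option T}) y : trace (B :\ Some y) = trace B :\ y.
Proof. by apply/setP=> z; rewrite !inE. Qed.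

Lemma trace_inj (B D : {set option T}) :
  (B == D) = (trace B == trace D) && ((None \in B) == (None \in D)).
Proof.
rewrite !eqEsubset !trace_subset.
by case: (_ \subset _); case: (_ \subset _); case: (_ \in _); case: (_ \in _).
Qed.

(** With [ws] equal to [enum F] this is the cone from [None] over the boundary of [F]; arbitrary
    lists give its partial shellings. *)
Definition stacked_simplex F (ws : seq T) : seq {set option T} :=
  [seq cone_face (F :\ w) | w <- ws].

(** The cone over [F :\ w] has as restriction the set of vertices whose opposite ridges were coned
    earlier. It is proper because it avoids [None]. *)
Lemma stacked_simplex_shelling d F (ws : seq T) :
    #|F| = d.+1 -> uniq ws -> {subset ws <= F} ->
  proper_shelling d (stacked_simplex F ws).
Proof.
move=> cF; elim: ws => [//|w ws IHws] /= /andP[wws uws] wsF.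
have wF : w \in F by apply: wsF; rewrite mem_head.
split.
- by rewrite card_cone -cF (cardsD1 w F) wF.
- exists (lift_face [set x in ws]).
    rewrite properE !trace_subset !trace_lift !trace_cone !inE /= andbF !andbT.
    rewrite subsetD1 inE wws andbT; apply/subsetP=> x; rewrite inE => xws.
    by apply: wsF; rewrite inE xws orbT.
  split=> [G /mapP[x xws ->]|[y|]]; last by rewrite inE.
    rewrite trace_subset trace_lift trace_cone negb_and; apply/orP; left.
    by rewrite subsetD1 inE xws andbF.
  rewrite !inE => yws; exists (cone_face (F :\ y)).
    by apply/mapP; exists y.
  rewrite trace_subset traceD1 !trace_cone !inE /= andbT.
  exact/setSD/subsetDl.
- by apply: IHws => // x xws; apply: wsF; rewrite inE xws orbT.
Qed.

Lemma mem_stacked F w :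
  w \in F -> cone_face (F :\ w) \in stacked_simplex F (enum F).
Proof. by move=> wF; apply/mapP; exists w; rewrite ?mem_enum. Qed.

(** The list being reversed, the first facet [F0] stands at its end. It is replaced by the cone over
    its boundary, and every later facet keeps its restriction, lifted. *)
Lemma stacking_shelling d s F0 :
    proper_shelling d (rcons s F0) ->
  proper_shelling d (map lift_face s ++ stacked_simplex F0 (enum F0)).
Proof.
move=> sh.
have cF0 : #|F0| = d.+1.
  by apply: (proper_shelling_card sh); rewrite mem_rcons mem_head.
have sh0 : proper_shelling d (stacked_simplex F0 (enum F0)).
  apply: stacked_simplex_shelling cF0 (enum_uniq _) _ => x.
  by rewrite mem_enum.
elim: s sh => [//|F s IHs] /= [cF [R RF [Rnew Rold]] /IHs sh].
have sRF := proper_sub RF.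
have RF0 : ~~ (R \subset F0) by apply: Rnew; rewrite mem_rcons mem_head.
split=> //; first by rewrite card_lift.
exists (lift_face R).
  by rewrite properE !trace_subset !trace_lift !inE /= !andbT -properE.
split=> [G|[y|]]; last by rewrite inE.
  rewrite mem_cat trace_subset trace_lift negb_and.
  case/orP=> /mapP[G' G's ->]; rewrite ?trace_lift ?trace_cone; apply/orP; left.
    by apply: Rnew; rewrite mem_rcons inE G's orbT.
  by apply: contra RF0 => /subset_trans; apply; apply: subsetDl.
rewrite !inE => yR; have [G] := Rold y yR.
rewrite mem_rcons inE => /predU1P[->|Gs] FG.
  (* A ridge of [F] that was old because of [F0] stays old: some [w] in [F0] is outside [F], so the
     ridge lies in the surviving face [F0 :\ w]. *)
  have /subsetPn[w wF0 wF] : ~~ (F0 \subset F).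
    apply: contra RF0 => F0F; suff -> : F0 = F by [].
    by apply/eqP; rewrite eqEcard F0F cF cF0 /=.
  exists (cone_face (F0 :\ w)).
    by rewrite mem_cat mem_stacked ?orbT.
  rewrite trace_subset traceD1 trace_lift trace_cone subsetD1 FG /=.
  by rewrite !inE (negbTE wF) andbF.
exists (lift_face G); first by rewrite mem_cat map_f.
by rewrite trace_subset traceD1 !trace_lift FG !inE.
Qed.

Lemma count_stacked_simplex F A :
  count (fun w => A \subset F :\ w) (enum F) = (A \subset F) * #|F :\: A|.
Proof.
have [AF|/negbTE AF] := boolP (A \subset F); last first.
  rewrite mul0n (@eq_count _ _ pred0) ?count_pred0 // => w.
  by rewrite subsetD1 AF.
rewrite mul1n -size_filter -(card_uniqP (filter_uniq _ (enum_uniq _))).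
apply: eq_card => w; rewrite mem_filter mem_enum !inE subsetD1 AF andbC.
by rewrite andbC.
Qed.

Lemma stacking d s F0 sigma : 0 < d ->
    unique_ridge_shelling d (rcons s F0) sigma ->
  unique_ridge_shelling d (map lift_face s ++ stacked_simplex F0 (enum F0))
    (lift_face sigma).
Proof.
move=> d0 [sh cov csig fr].
have cs := fun F => @proper_shelling_card _ d (rcons s F0) F sh.
have cF0 : #|F0| = d.+1 by apply: cs; rewrite mem_rcons mem_head.
split; first exact: stacking_shelling.
- case=> [t|]; last first.
    have /card_gt0P[w wF0] : 0 < #|F0| by rewrite cF0.
    exists (cone_face (F0 :\ w)); last by rewrite inE.
    by rewrite mem_cat mem_stacked ?orbT.
  have [F] := cov t; rewrite mem_rcons inE => /predU1P[->|Fs] tF; last first.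
    by exists (lift_face F); rewrite ?inE // mem_cat map_f.
  have /card_gt0P[w] : 0 < #|F0 :\ t|.
    by have := cardsD1 t F0; rewrite tF cF0; lia.
  rewrite !inE => /andP[wt wF0]; exists (cone_face (F0 :\ w)).
    by rewrite mem_cat mem_stacked ?orbT.
  by rewrite !inE eq_sym wt.
- by rewrite card_lift.
- move=> B; rewrite card_trace => cB.
  rewrite count_cat !count_map.
  rewrite [X in X + _](@eq_count _ _
    (fun F : {set T} => (trace B \subset F) && (None \notin B))); last first.
    by move=> F /=; rewrite trace_subset trace_lift !inE implybF.
  rewrite [X in _ + X](@eq_count _ _ (fun w => trace B \subset F0 :\ w)); last first.
    by move=> w /=; rewrite trace_subset trace_cone !inE implybT andbT.
  rewrite count_stacked_simplex trace_inj trace_lift inE.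
  (* A ridge through [None] lies in two new facets or in none, so it is never free. A ridge avoiding
     [None] lies in one new facet exactly when it lay in [F0], so its count is unchanged. *)
  have cD : trace B \subset F0 -> #|F0 :\: trace B| = (None \in B).+1.
    by move=> BF; rewrite cardsD (setIidPr BF) cF0 -cB -addSn addnK.
  case: (None \in B) cB cD => /= cB cD.
    rewrite (@eq_count _ _ pred0) ?count_pred0; last by move=> F; rewrite /= andbF.
    rewrite andbF; case: (boolP (trace B \subset F0)) => [/cD->|_] //.
  rewrite andbT -fr // -cats1 count_cat /= addn0.
  rewrite (@eq_count _ _ (fun F : {set T} => trace B \subset F));
    last by move=> F; rewrite andbT.
  by case: (boolP (trace B \subset F0)) => [/cD->|_] //; rewrite mul1n.
Qed.

(** * One-point suspension at a vertex *)

Section OnePointSuspension.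
Variable v : T.

(** The suspension points are [v] and [None]. When [F] avoids [v], the cone from [None] comes second
    in the list and is therefore added first. *)
Definition suspension_facets F : seq {set option T} :=
  if v \in F then [:: cone_face F] else [:: lift_face (v |: F); cone_face F].

Definition suspension s : seq {set option T} :=
  flatten (map suspension_facets s).

Lemma suspensionP s (H : {set option T}) :
  reflect (exists2 F : {set T}, F \in s &
            H = cone_face F \/ (v \notin F /\ H = lift_face (v |: F)))
          (H \in suspension s).
Proof.
apply: (iffP flatten_mapP) => -[F Fs HF]; exists F => //.
  move: HF; rewrite /suspension_facets; case: ifP => vF; rewrite !inE.
    by move/eqP; left.
  by case/orP=> /eqP ->; [right|left].
rewrite /suspension_facets; case: HF => [->|[/negbTE-> ->]].
  by case: ifP; rewrite !inE eqxx ?orbT.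
by rewrite mem_head.
Qed.

Lemma sub_adjoin R F : v \notin R -> (R \subset v |: F) = (R \subset F).
Proof.
move=> vR; apply/idP/idP => [RF|/subset_trans]; last by apply; apply: subsetUr.
apply/subsetP=> x xR; move/subsetP/(_ x xR): RF; rewrite !inE.
by case/predU1P=> // xv; rewrite -xv xR in vR.
Qed.

Lemma suspension_restriction_lift s F R :
    R \subset F -> v \notin R -> restriction s F R ->
  restriction (suspension s) (cone_face F) (lift_face R).
Proof.
move=> RF vR [Rnew Rold]; split=> [H /suspensionP[G Gs]|[y|]]; last by rewrite inE.
  case=> [->|[vG ->]]; rewrite trace_subset !trace_lift ?trace_cone negb_and.
    by rewrite Rnew.
  by rewrite sub_adjoin // Rnew.
rewrite inE => /Rold[G Gs FG]; exists (cone_face G).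
  by apply/suspensionP; exists G; [|left].
by rewrite trace_subset traceD1 !trace_cone FG !inE.
Qed.

(** Here [R] contains [v] and may lie in an earlier facet [lift_face (v |: G)], so [None] is
    adjoined to make it new. The face opposite [None] is old: the facet [G] covering [F :\ v] avoids
    [v], as it would otherwise contain [R]. *)
Lemma suspension_restriction_cone s F R :
    R \subset F -> v \in R -> restriction s F R ->
  restriction (suspension s) (cone_face F) (cone_face R).
Proof.
move=> RF vR [Rnew Rold]; split=> [H /suspensionP[G Gs]|[y|_]].
  case=> [->|[vG ->]]; rewrite trace_subset ?trace_lift !trace_cone negb_and.
    by rewrite Rnew.
  by rewrite !inE orbT.
- rewrite inE => /Rold[G Gs FG]; exists (cone_face G).
    by apply/suspensionP; exists G; [|left].
  by rewrite trace_subset traceD1 !trace_cone FG !inE.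
- have [G Gs FG] := Rold v vR.
  have vG : v \notin G.
    apply/negP => vG; have /negP[] := Rnew G Gs; apply: (subset_trans RF).
    by rewrite -(setD1K (subsetP RF v vR)) subUset sub1set vG.
  exists (lift_face (v |: G)); first by apply/suspensionP; exists G; [|right].
  rewrite trace_subset trace_lift !inE /= andbT.
  apply/subsetP=> x; rewrite !inE /= => xF; case: eqVneq => //= xv.
  by apply: (subsetP FG); rewrite !inE xv.
Qed.

(** The cone over [F] was added just before and contains the ridge opposite [v], which is why [v]
    joins the restriction. *)
Lemma suspension_restriction_lift2 s F R :
    R \subset F -> v \notin F -> restriction s F R ->
  restriction (cone_face F :: suspension s) (lift_face (v |: F))
    (lift_face (v |: R)).
Proof.
move=> RF vF [Rnew Rold].
have vR : v \notin R by apply: contra vF => /(subsetP RF).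
split=> [H|[y|]]; last by rewrite inE.
  rewrite inE => /predU1P[->|/suspensionP[G Gs]].
    by rewrite trace_subset trace_lift trace_cone subUset sub1set (negbTE vF).
  case=> [->|[vG ->]]; rewrite trace_subset !trace_lift ?trace_cone negb_and.
    by rewrite subUset (negbTE (Rnew G Gs)) andbF.
  by rewrite subUset (sub_adjoin G vR) (negbTE (Rnew G Gs)) andbF.
rewrite !inE => /predU1P[->|yR].
  exists (cone_face F); rewrite ?mem_head // trace_subset traceD1 trace_lift.
  by rewrite trace_cone setU1K ?subxx ?inE.
have [G Gs FG] := Rold y yR.
case: (boolP (v \in G)) => vG.
  exists (cone_face G).
    by rewrite inE; apply/orP; right; apply/suspensionP; exists G; [|left].
  rewrite trace_subset traceD1 trace_lift trace_cone !inE andbT.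
  apply/subsetP=> x; rewrite !inE => /andP[xy /predU1P[-> //|xF]].
  by apply: (subsetP FG); rewrite !inE xy.
exists (lift_face (v |: G)).
  by rewrite inE; apply/orP; right; apply/suspensionP; exists G; [|right].
rewrite trace_subset traceD1 !trace_lift !inE andbT.
apply/subsetP=> x; rewrite !inE => /andP[xy /predU1P[-> |xF]].
  by rewrite eqxx.
by apply/orP; right; apply: (subsetP FG); rewrite !inE xy.
Qed.

Lemma suspension_shelling d s :
  proper_shelling d s -> proper_shelling d.+1 (suspension s).
Proof.
elim: s => [//|F s IHs] [cF [R RF res] /IHs sh]; rewrite /suspension /=.
rewrite -/(suspension s) /suspension_facets.
have sRF := proper_sub RF.
case: ifPn => vF /=.
  split; rewrite ?card_cone ?cF //; case: (boolP (v \in R)) => vR.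
    exists (cone_face R); last exact: suspension_restriction_cone.
    by rewrite properE !trace_subset !trace_cone !inE !andbT -properE.
  exists (lift_face R); last exact: suspension_restriction_lift.
  by rewrite properE !trace_subset !trace_cone !trace_lift !inE sRF /= andbF.
have vR : v \notin R by apply: contra vF => /(subsetP sRF).
split; first by rewrite card_lift cardsU1 vF cF.
  exists (lift_face (v |: R)); last exact: suspension_restriction_lift2.
  have /properP[_ [x xF xR]] := RF.
  rewrite properE !trace_subset !trace_lift !inE !andbT setUS //=.
  apply/subsetPn; exists x; rewrite !inE ?xF ?orbT // (negbTE xR) orbF.
  by apply: contra vF => /eqP <-.
split=> //; first by rewrite card_cone cF.
exists (lift_face R); last exact: suspension_restriction_lift.
by rewrite properE !trace_subset !trace_cone !trace_lift !inE sRF /= andbF.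
Qed.

Lemma count_suspension s (B : {set option T}) :
  count (fun H : {set option T} => B \subset H) (suspension s)
  = count (fun F : {set T} => trace B \subset F) s
    + count (fun F : {set T} => [&& v \notin F, None \notin B & trace B \subset v |: F]) s.
Proof.
elim: s => [//|F s IHs]; rewrite /suspension /= count_cat -/(suspension s) IHs.
rewrite /suspension_facets; case: (v \in F) => /=;
  rewrite !trace_subset ?trace_lift trace_cone !inE implybT andbT /=.
  by rewrite addn0 add0n addnA.
by rewrite addn0 implybF andbC [X in X + _]addnC addnACA.
Qed.

(** A ridge [B] through [None] is counted like its trace. If it contains [v] but not [None], it is
    counted like its trace without [v], which is not [sigma]. If it avoids both, its count is
    even. *)
Lemma one_point_suspension d s (sigma : {set T}) : v \in sigma ->
    unique_ridge_shelling d s sigma ->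
  unique_ridge_shelling d.+1 (suspension s) (cone_face sigma).
Proof.
move=> vsig [sh cov csig fr].
have cs := fun F => @proper_shelling_card _ d s F sh.
split; first exact: suspension_shelling.
- have inS F : F \in s -> cone_face F \in suspension s.
    by move=> Fs; apply/suspensionP; exists F; [|left].
  case=> [t|]; last first.
    by have [F Fs _] := cov v; exists (cone_face F); rewrite ?inE ?inS.
  by have [F Fs tF] := cov t; exists (cone_face F); rewrite ?inE ?inS.
- by rewrite card_cone csig.
move=> B; rewrite card_trace count_suspension trace_inj trace_cone !inE.
case: (None \in B) => /= cB.
  rewrite [X in _ + X](@eq_count _ _ pred0) ?count_pred0; last by move=> F; rewrite /= andbF.
  by rewrite addn0 andbT; apply: fr; case: cB.
rewrite andbF.
case: (boolP (v \in trace B)) => [vB|vB].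
  have BE F : (trace B \subset F) + ((v \notin F) && (trace B \subset v |: F))
      = (trace B :\ v \subset F) :> nat.
    have BvE : (trace B \subset v |: F) = (trace B :\ v \subset F).
      by rewrite -{1}(setD1K vB) subUset sub1set setU11 /= sub_adjoin // !inE eqxx.
    rewrite BvE -{1}(setD1K vB) subUset sub1set.
    by case: (v \in F) => //=; rewrite addn0.
  have -> : forall s', count (fun F : {set T} => trace B \subset F) s'
      + count (fun F : {set T} => (v \notin F) && (trace B \subset v |: F)) s'
      = count (fun F : {set T} => trace B :\ v \subset F) s'.
    by elim=> [//|F s' IH] /=; rewrite -IH -BE; lia.
  rewrite fr; last by have := cardsD1 v (trace B); rewrite vB; lia.
  by apply/negbTE; apply: contraTneq vsig => <-; rewrite !inE eqxx.
(* The trace has d + 1 elements, so a facet containing it equals it and avoids [v]; hence both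
   counts agree and their sum is not 1. *)
rewrite [X in _ + X](@eq_in_count _ _ (fun F : {set T} => trace B \subset F)).
  by rewrite addnn; apply/eqP => /(congr1 odd); rewrite odd_double.
move=> F Fs /=; rewrite sub_adjoin //; case: (boolP (v \in F)) => //= vF.
apply/esym/negbTE; apply: contra vB => BF.
suff -> : trace B = F by [].
by apply/eqP; rewrite eqEcard BF cs //= -cB.
Qed.

End OnePointSuspension.
End NewVertex.

(** * The base complex on seven vertices *)

Section BaseCase.

(** Faces are given by lists of numbers so that the finite checks become computations. *)
Definition face (l : seq nat) : {set 'I_7} := [set x : 'I_7 | val x \in l].

Lemma subset_face (l m : seq nat) : all (fun x => x < 7) l ->
  (face l \subset face m) = all (fun x => x \in m) l.
Proof.
move=> /allP l7; apply/subsetP/allP => [lm x xl|lm x].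
  by have := lm (Ordinal (l7 x xl)); rewrite !inE; apply.
by rewrite !inE => /lm.
Qed.

Lemma card_face (l : seq nat) :
  uniq l -> all (fun x => x < 7) l -> #|face l| = size l.
Proof.
move=> ul /allP l7; rewrite cardE -(size_map val); apply: perm_size.
apply: uniq_perm ul _; first by rewrite (map_inj_uniq val_inj) enum_uniq.
move=> x; apply/mapP/idP => [[y]|xl].
  by rewrite mem_enum inE => yl ->.
by exists (Ordinal (l7 x xl)); rewrite // mem_enum inE.
Qed.

(* Pairs of a facet and its restriction, latest facet first. *)
Fixpoint shelling_check (ps : seq (seq nat * seq nat)) : bool :=
  if ps is p :: ps' then
    [&& [&& uniq p.1, size p.1 == 3, all (fun x => x < 7) p.1
          & all (fun x => x < 7) p.2],
        all (fun x => x \in p.1) p.2, ~~ all (fun x => x \in p.2) p.1,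
        all (fun q => ~~ all (fun x => x \in q.1) p.2) ps',
        all (fun y => has (fun q => all (fun x => (x == y) || (x \in q.1)) p.1)
                          ps') p.2
      & shelling_check ps']
  else true.

Lemma shelling_check_sound ps :
  shelling_check ps -> proper_shelling 2 [seq face p.1 | p <- ps].
Proof.
elim: ps => [//|[f r] ps IHps] /= /and5P[/and4P[uf /eqP sf f7 r7]].
move=> rf nfr /allP new /andP[/allP old /IHps sh].
split=> //; first by rewrite card_face // sf.
exists (face r); first by rewrite properE !subset_face // rf.
split=> [G /mapP[q /new qr ->]|y]; first by rewrite subset_face.
rewrite inE => /old/hasP[q qps /allP fq]; exists (face q.1).
  by apply/mapP; exists q.
apply/subsetP=> x; rewrite !inE => /andP[xy /fq].
by rewrite (inj_eq val_inj) (negbTE xy).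
Qed.

(* Found by a random search over shellings on 7 vertices. *)
Definition base_triangles : seq (seq nat * seq nat) :=
  [:: ([:: 1; 5; 6], [:: 1; 5]); ([:: 3; 5; 6], [:: 5; 6]);
      ([:: 1; 4; 6], [:: 1; 6]); ([:: 0; 3; 6], [:: 3; 6]);
      ([:: 0; 4; 6], [:: 6]); ([:: 0; 1; 3], [:: 0; 3]);
      ([:: 3; 4; 5], [:: 3; 5]); ([:: 0; 4; 5], [:: 0; 4]);
      ([:: 0; 2; 5], [:: 0; 5]); ([:: 2; 4; 5], [:: 5]);
      ([:: 1; 3; 4], [:: 3]); ([:: 1; 2; 4], [:: 4]); ([:: 0; 1; 2], [::])].

Lemma base_complex :
  unique_ridge_shelling 2 [seq face p.1 | p <- base_triangles]
    (face [:: 1; 5]).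
Proof.
split; first exact: shelling_check_sound.
- move=> t.
  have : all (fun x => has (fun p => x \in p.1) base_triangles) (iota 0 7) by [].
  move/allP/(_ (val t)); rewrite mem_iota => /(_ (ltn_ord t))/hasP[p pb tp].
  by exists (face p.1); [apply/mapP; exists p|rewrite inE].
- exact: card_face.
move=> A /eqP/cards2P[x [y [xy ->]]]; rewrite count_map.
rewrite (@eq_count _ _ (fun p => (val x \in p.1) && (val y \in p.1))); last first.
  by move=> p /=; rewrite subUset !sub1set !inE.
have -> : ([set x; y] == face [:: 1; 5])
    = (val x \in [:: 1; 5]) && (val y \in [:: 1; 5]).
  by rewrite eqEcard card_face // cards2 xy andbT subUset !sub1set !inE.
(* Exhaustive check over all pairs of distinct vertices that only the edge {1, 5} lies in exactly
   one triangle. *)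
have : all (fun a => all (fun b => (a != b) ==>
    ((count (fun p => (a \in p.1) && (b \in p.1)) base_triangles == 1)
     == (a \in [:: 1; 5]) && (b \in [:: 1; 5]))) (iota 0 7)) (iota 0 7).
  by vm_compute.
move/allP/(_ (val x)); rewrite mem_iota => /(_ (ltn_ord x)).
move/allP/(_ (val y)); rewrite mem_iota => /(_ (ltn_ord y)).
by rewrite (inj_eq val_inj) xy => /eqP.
Qed.

End BaseCase.

(** * Reaching the required dimension and number of vertices *)

Definition realizable d n : Prop :=
  exists (T : finType) (s : seq {set T}) (sigma : {set T}),
    unique_ridge_shelling d s sigma /\ #|T| = n.

Lemma realizable_stack d n : 0 < d -> realizable d n -> realizable d n.+1.
Proof.
move=> d0 [T [s [sigma [H cT]]]].
case/lastP: s H => [|s F0] H; first by have := unique_ridge_nonempty H.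
do 3 eexists; split; first exact: stacking d0 H.
by rewrite card_option cT.
Qed.

Lemma realizable_suspension d n :
  0 < d -> realizable d n -> realizable d.+1 n.+1.
Proof.
move=> d0 [T [s [sigma [H cT]]]].
have /card_gt0P[v vsig] : 0 < #|sigma| by rewrite (urs_card H).
do 3 eexists; split; first exact: one_point_suspension vsig H.
by rewrite card_option cT.
Qed.

Theorem theorem2p3 (d : nat) (hd : 2 <= d) :
  exists (T : finType) (C : {set {set T}}),
    is_complex C /\
    complex_dim C = d%:Z%R /\
    #|vertices C| = 2 ^ d + d + 1 /\
    collapsible C /\
    shellable C /\
    #|[set sigma | free_face C sigma]| = 1.
Proof.
(* [realizable] hides the vertex type, which each operation changes from [T] to [option T], so plain
   induction applies. *)
have stacked k : realizable 2 (7 + k).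
  elim: k => [|k IHk]; last by rewrite addnS; apply: realizable_stack.
  by do 3 eexists; split; [exact: base_complex|rewrite card_ord].
have suspended j k : realizable (2 + j) (7 + k + j).
  elim: j => [|j IHj]; first by rewrite !addn0.
  by rewrite !addnS; apply: realizable_suspension.
(* The vertices add up to 7 + (2^d - 4) + (d - 2) = 2^d + d + 1; neither subtraction truncates since
   d is at least 2. *)
have [T [s [sigma [H cT]]]] := suspended (d - 2) (2 ^ d - 4).
rewrite subnKC // in H.
exists T, (generated_complex s).
have -> : 2 ^ d + d + 1 = #|T|.
  have : 2 ^ 2 <= 2 ^ d by rewrite leq_exp2l.
  by rewrite cT; lia.
exact: unique_ridge_complex H.
Qed.
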